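(* Let $X_1,X_2,\ldots,X_n$ be a sequence of independent Bernoulli random variables with $P(X_i=1)=p_i<\log 2$, $i=1,\ldots,n$, and let $\lambda=\sum_{i=1}^n p_i$. Then $$d_{\mathrm{TV}}\Bigl(\mathcal{L}\sum_{i=1}^n X_i,\mathit{Po}(\lambda)\Bigr)\le\Bigl(\sum_{i=1}^n p_i^2\Bigr)^2+\frac14\bigl\Vert\Delta^2 f_{\mathit{Po}(\lambda)}\bigr\Vert_1\sum_{i=1}^n\frac{p_i^2}{1-2(1-\mathrm{e}^{-p_i})}.$$
   Context: $\mathcal{L}X$ denotes the distribution of $X$. For distributions on $\mathbb{Z}$, $d_{\mathrm{TV}}(\mathcal{L}X,\mathcal{L}Y)=\sup_{A\subseteq\mathbb{Z}}|P(X\in A)-P(Y\in A)|=\frac12\sum_{k\in\mathbb{Z}}|P(X=k)-P(Y=k)|$. $\mathit{Po}(\lambda)$ is the Poisson distribution with mean $\lambda$ and $f_{\mathit{Po}(\lambda)}:\mathbb{Z}\to\mathbb{R}$ its probability mass function (zero on negative integers). For $f:\mathbb{Z}\to\mathbb{R}$, $\Delta f(i)=f(i)-f(i-1)$, $\Delta^2 f=\Delta(\Delta f)$, $\Vert\Delta^2 f\Vert_1=\sum_{z\in\mathbb{Z}}|\Delta^2 f(z)|$. *)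

(* Defs.v *)
From HB Require Import structures.
From mathcomp Require Import all_boot all_order all_algebra.
From mathcomp Require Import all_classical all_reals all_analysis.

Set Implicit Arguments.
Unset Strict Implicit.
Unset Printing Implicit Defensive.

Import Order.TTheory GRing.Theory Num.Theory.

Local Open Scope classical_set_scope.
Local Open Scope ring_scope.

HB.instance Definition _ := isPointed.Build int 0.
HB.instance Definition _ := @isMeasurable.Build default_measure_display
  int discrete_measurable discrete_measurable0
  discrete_measurableC discrete_measurableU.

(* The total variation distance; every subset of int is measurable. *)
Definition dTV (R : realType) (mu nu : probability int R) : \bar R :=
  ereal_sup [set `|mu A - nu A|%E | A in [set: set int]].

Definition pmfZ (R : realType) (mu : probability int R) (z : int) : R :=
  fine (mu [set z]).

Definition backward_diff (R : realType) (f : int -> R) (z : int) : R :=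
  f z - f (z - 1).

Definition l1normZ (R : realType) (f : int -> R) : \bar R :=
  \esum_(z in [set: int]) (`|f z|)%:E.

Lemma measurable_Posz : measurable_fun [set: nat] Posz.
Proof. by []. Qed.

HB.instance Definition _ := isMeasurableFun.Build _ _ _ _ Posz measurable_Posz.

(* The Poisson law on nat pushed forward to int.  The second argument of poisson_prob is unused by the library. For
   lambda = 0 the library measure is the Dirac measure at 0, whereas
   poisson_pmf 0 is not a mass function. *)
Definition poissonZ (R : realType) (lambda : R) : probability int R :=
  distribution (poisson_prob lambda 0%N) Posz.

Lemma pmfZ_poissonZ (R : realType) (lambda : R) (z : int) : 0 <= lambda ->
  pmfZ (poissonZ lambda) z =
  if z is Posz k then lambda ^+ k / k`!%:R * expR (- lambda) else 0.
Proof.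
move=> l0; rewrite /pmfZ /poissonZ /distribution /= /pushforward.
case: z => k; last first.
  rewrite (_ : _ @^-1` _ = set0) ?measure0//.
  by apply/seteqP; split => // m.
rewrite (_ : _ @^-1` _ = [set k]); last first.
  by apply/seteqP; split => [m [->]|m ->].
rewrite /poisson_prob; case: ifPn => [lgt0|].
  rewrite esum_set1 /= ?lee_fin ?poisson_pmf_ge0//.
  by rewrite /poisson_pmf lgt0.
rewrite -leNgt => le0; have -> : lambda = 0 by apply/eqP; rewrite eq_le le0.
rewrite diracE in_set1 oppr0 expR0 mulr1.
by case: k => [|k]; rewrite ?expr0 ?fact0 ?invr1 ?mulr1// exprS !mul0r.
Qed.

Section random_variables.
Context d (T : measurableType d).

Lemma measurable_add_int (f g : T -> int) :
  measurable_fun [set: T] f -> measurable_fun [set: T] g ->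
  measurable_fun [set: T] (fun w => f w + g w).
Proof.
move=> mf mg _ B _; rewrite setTI.
rewrite (_ : _ @^-1` B =
    \bigcup_a (f @^-1` [set a] `&` g @^-1` [set b | B (a + b)])); last first.
  by apply/seteqP; split => [w Bw|w [a _ [<-]]//]; exists (f w).
apply: countable_bigcupT_measurable => [|a]; first exact: countableP.
by apply: measurableI; rewrite -[X in measurable X]setTI; [exact: mf|exact: mg].
Qed.

Definition sum_int (I : finType) (X : I -> {mfun T >-> int}) (w : T) : int :=
  \sum_(i : I) X i w.

Lemma measurable_sum_int (I : finType) (X : I -> {mfun T >-> int}) :
  measurable_fun [set: T] (sum_int X).
Proof.
rewrite /sum_int; elim: (index_enum I) => [|i s IHs].
  by under eq_fun do rewrite big_nil; exact: measurable_cst.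
under eq_fun do rewrite big_cons.
exact: measurable_add_int.
Qed.

HB.instance Definition _ (I : finType) (X : I -> {mfun T >-> int}) :=
  isMeasurableFun.Build _ _ _ _ (sum_int X) (measurable_sum_int X).

Context (R : realType) (P : probability T R).

(* Mutual independence; J = set0 reads P setT = 1. *)
Definition independent_RVs d' (T' : measurableType d') (I : finType)
    (X : I -> {RV P >-> T'}) : Prop :=
  forall (J : {set I}) (A : I -> set T'),
    (forall i, i \in J -> measurable (A i)) ->
    P (\bigcap_(i in [set` J]) (X i @^-1` A i)) =
    (\prod_(i in J) P (X i @^-1` A i))%E.

(* The values 0 and 1 are taken almost surely. *)
Definition bernoulli_RV (X : {RV P >-> int}) (p : R) : Prop :=
  P (X @^-1` [set 1]) = p%:E /\ P (X @^-1` [set 0]) = (1 - p)%:E.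

End random_variables.

Arguments independent_RVs {d T R} P {d' T' I} X.
Arguments bernoulli_RV {d T R} P X p.

(* Main.v *)
Require Import Defs.
From mathcomp Require Import all_boot all_order all_algebra.
From mathcomp Require Import all_classical all_reals all_analysis.
From mathcomp Require Import ring lra.

Import Order.TTheory GRing.Theory Num.Theory.

Local Open Scope classical_set_scope.
Local Open Scope ring_scope.

(** In the algebra of summable sequences on [nat] under convolution, let [D]
be the difference operator, that is, multiplication by [1 - 'X] of generating
functions.  The Bernoulli law of mean [p] is [1 - p D] and the Poisson law of
mean [p] is [exp (- p D)], so they agree to first order in [D].  More precisely
the Poisson law minus the Bernoulli law is [D^2 h], where [h k] is the expectation of [(Z - (k + 1))^+]
for a Poisson variable [Z] of mean [p]; thus [h >= 0] and the total mass of [h]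
is half the second factorial moment of [Z], that is [p^2 / 2].  This gives the
first order error of each summand ([poisson_sub_bernoulli],
[trunc_norm_stop_loss]).

Replacing one Bernoulli factor after the other by its Poisson counterpart
writes the difference between the two laws as the sum over [i] of
[(Bernoulli p_i - Poisson p_i) * Poisson (lambda - p_i)] plus a remainder in
which every term contains two such differences.  Since each difference has norm
at most [2 p_i^2] and total variation is half the norm, the remainder accounts
for the square of the sum of the [p_i^2] ([trunc_norm_prod_bernoulli2]).

For the main terms, [D^2] moves from [h] to [Poisson (lambda - p_i)].  To pass
from [lambda - p_i] to [lambda], note that the Poisson law of mean [p] has an
atom of mass [exp (- p)] at [0]: convolving with it multiplies norms by at least
[exp (- p) - (1 - exp (- p)) = 1 - 2 (1 - exp (- p))]
([trunc_norm_deconvolve]).  This number is positive exactly when [p < ln 2],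
which is where the hypothesis enters ([trunc_norm_main_term]).

All these norm estimates survive truncation of the sequences to the indices
below [N], uniformly in [N].  Hence sequences are represented by polynomials
[a], measured by the seminorm summing [`|a`_k|] over [k < N]; that
[a] and [b] agree up to index [N] is expressed as [trunc_norm N (a - b) = 0].
Only at the end does [N] tend to infinity, when total variation is recovered
([dTV_le_half_l1]). *)

(** * Truncated l1 seminorms of polynomials *)

Section trunc_norm.
Context {R : numDomainType}.
Implicit Types (N : nat) (a b : {poly R}).

Definition trunc_norm N a : R := \sum_(k < N) `|a`_k|.

Lemma trunc_norm_ge0 N a : 0 <= trunc_norm N a.
Proof. exact: sumr_ge0. Qed.

Lemma trunc_normD N a b : trunc_norm N (a + b) <= trunc_norm N a + trunc_norm N b.
Proof.
by rewrite -big_split ler_sum// => k _; rewrite coefD ler_normD.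
Qed.

Lemma trunc_normN N a : trunc_norm N (- a) = trunc_norm N a.
Proof. by apply: eq_bigr => k _; rewrite coefN normrN. Qed.

Lemma trunc_normB N a b : trunc_norm N (a - b) <= trunc_norm N a + trunc_norm N b.
Proof. by rewrite -(trunc_normN N b) trunc_normD. Qed.

Lemma trunc_norm0 N : trunc_norm N 0 = 0.
Proof. by apply: big1 => k _; rewrite coef0 normr0. Qed.

Lemma trunc_norm_sum N I (r : seq I) (F : I -> {poly R}) :
  trunc_norm N (\sum_(i <- r) F i) <= \sum_(i <- r) trunc_norm N (F i).
Proof.
elim/big_ind2: _ => [|x1 x2 y1 y2 h1 h2|//]; first by rewrite trunc_norm0.
by rewrite (le_trans (trunc_normD _ _ _)) ?lerD.
Qed.

Lemma trunc_norm_eq N a b : (forall k, (k < N)%N -> a`_k = b`_k) ->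
  trunc_norm N (a - b) = 0.
Proof.
by move=> ab; apply: big1 => k _; rewrite coefB ab// subrr normr0.
Qed.

Lemma trunc_norm_XnM N i a : trunc_norm N ('X^i * a) <= trunc_norm N a.
Proof.
elim: i => [|i IH]; first by rewrite expr0 mul1r.
apply: le_trans IH; rewrite exprS -mulrA; case: N => [|N].
  by rewrite /trunc_norm !big_ord0.
rewrite /trunc_norm big_ord_recl coefXM normr0 add0r big_ord_recr/=.
by rewrite ler_wpDr//; apply: ler_sum => k _; rewrite coefXM.
Qed.

(** The coefficients of a product below [N] only involve those of the factors
below [N], so Young's inequality for convolutions holds for truncated norms. *)
Lemma trunc_normM N a b : trunc_norm N (a * b) <= trunc_norm N a * trunc_norm N b.
Proof.
have coefMX k : (k < N)%N -> (a * b)`_k = \sum_(i < N) a`_i * ('X^i * b)`_k.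
  move=> kN; rewrite coefM (big_ord_widen N (fun i => a`_i * b`_(k - i)))//.
  rewrite big_mkcond; apply: eq_bigr => i _.
  by rewrite coefXnM ltnS; case: ltnP; rewrite ?mulr0.
rewrite (@le_trans _ _ (\sum_(k < N) \sum_(i < N) `|a`_i| * `|('X^i * b)`_k|))//.
  apply: ler_sum => k _; rewrite coefMX//.
  by rewrite (le_trans (ler_norm_sum _ _ _))// ler_sum// => i _; rewrite normrM.
rewrite exchange_big/= mulr_suml ler_sum// => i _.
by rewrite -mulr_sumr ler_wpM2l// trunc_norm_XnM.
Qed.

Lemma trunc_norm_congr N a b :
  trunc_norm N (a - b) = 0 -> trunc_norm N a <= trunc_norm N b.
Proof.
by move=> ab; rewrite -(subrK b a) (le_trans (trunc_normD _ _ _))// ab add0r.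
Qed.

Lemma trunc_norm_mul0 N a b : trunc_norm N a = 0 -> trunc_norm N (a * b) = 0.
Proof.
move=> a0; apply/eqP; rewrite eq_le trunc_norm_ge0 andbT.
by rewrite (le_trans (trunc_normM _ _ _))// a0 mul0r.
Qed.

Lemma trunc_normZ N k a : trunc_norm N (k *: a) = `|k| * trunc_norm N a.
Proof.
by rewrite /trunc_norm mulr_sumr; apply: eq_bigr => i _; rewrite coefZ normrM.
Qed.

Lemma trunc_norm_1B'XM N a : trunc_norm N ((1 - 'X) * a) <= 2 * trunc_norm N a.
Proof.
rewrite mulrBl mul1r (le_trans (trunc_normB _ _ _))// mulrDl mul1r lerD2l.
by rewrite -['X]expr1 trunc_norm_XnM.
Qed.

Lemma coef_1B'XM a k : ((1 - 'X) * a)`_k = a`_k - (if k is k'.+1 then a`_k' else 0).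
Proof. by rewrite mulrBl mul1r coefB coefXM; case: k. Qed.

End trunc_norm.

(** * The Poisson mass function and its moments *)

Section poisson_mass.
Context {R : realType}.
Implicit Types (x y : R) (k N : nat).

Definition poisson_mass x k : R := x ^+ k / k`!%:R * expR (- x).

Lemma poisson_mass_ge0 x k : 0 <= x -> 0 <= poisson_mass x k.
Proof. by move=> x0; rewrite !mulr_ge0 ?invr_ge0 ?exprn_ge0 ?expR_ge0. Qed.

Lemma poisson_massS x k : k.+1%:R * poisson_mass x k.+1 = x * poisson_mass x k.
Proof.
rewrite /poisson_mass factS natrM exprS; field.
by rewrite pnatr_eq0 -lt0n fact_gt0/= addrC natr1 pnatr_eq0.
Qed.

Lemma poisson_massD x y k : \sum_(i < k.+1) poisson_mass x i * poisson_mass y (k - i)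
  = poisson_mass (x + y) k.
Proof.
rewrite /poisson_mass addrC exprDn opprD expRD !mulr_suml; apply: eq_bigr => -[i/= ik] _.
rewrite -(bin_fact (ltnSE ik)) !natrM -mulr_natr; field.
by rewrite !pnatr_eq0 -!lt0n !fact_gt0 bin_gt0 -ltnS ik.
Qed.

Lemma poisson_mass_cvg1 x : \sum_(k < N) poisson_mass x k @[N --> \oo] --> (1 : R^o).
Proof.
have -> : (fun N => \sum_(k < N) poisson_mass x k) =
    (fun N => series (exp_coeff x) N * expR (- x)).
  apply/funext => N; rewrite /series/= big_mkord mulr_suml.
  by apply: eq_bigr => k _.
rewrite -(expRxMexpNx_1 x); exact: cvgMr_tmp (is_cvg_series_exp_coeff x).
Qed.

Lemma poisson_mass_mean x N :
  \sum_(k < N.+1) k%:R * poisson_mass x k = x * \sum_(k < N) poisson_mass x k.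
Proof.
rewrite big_ord_recl mul0r add0r mulr_sumr; apply: eq_bigr => k _.
exact: poisson_massS.
Qed.

Lemma poisson_mass_mean2 x N :
  \sum_(k < N.+2) k%:R * (k%:R - 1) * poisson_mass x k =
  x ^+ 2 * \sum_(k < N) poisson_mass x k.
Proof.
rewrite big_ord_recl !mul0r add0r expr2 -mulrA -poisson_mass_mean mulr_sumr.
apply: eq_bigr => k _; rewrite [RHS]mulrCA -poisson_massS.
by rewrite lift0 -natr1; ring.
Qed.

(** The right hand side is the expectation of the quadratic under the full
Poisson law, and dropping the indices from
[N] on, where the quadratic is nonnegative, can only decrease it.  The quadratic
is expanded in falling factorials, whose Poisson moments are powers of [x]. *)
Lemma poisson_mass_quad_le x a b c N : 0 <= x ->
  (forall k, (N <= k)%N -> 0 <= a * (k%:R * (k%:R - 1)) + b * k%:R + c) ->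
  \sum_(k < N) (a * (k%:R * (k%:R - 1)) + b * k%:R + c) * poisson_mass x k
    <= a * x ^+ 2 + b * x + c.
Proof.
move=> x0 g0; pose g k : R := (a * (k%:R * (k%:R - 1)) + b * k%:R + c) * poisson_mass x k.
rewrite [leLHS](_ : _ = \sum_(k < N) g k)//.
pose f M := \sum_(k < M) poisson_mass x k.
have gE M : \sum_(k < M.+2) g k = a * (x ^+ 2 * f M) + b * (x * f M.+1) + c * f M.+2.
  rewrite -poisson_mass_mean2 -poisson_mass_mean !mulr_sumr -!big_split.
  by apply: eq_bigr => k _; rewrite /g/=; ring.
have f1 m : f (M + m)%N @[M --> \oo] --> (1 : R^o).
  by rewrite (cvg_shiftn m f); exact: poisson_mass_cvg1.
have glim : \sum_(k < M.+2) g k @[M --> \oo] --> a * x ^+ 2 + b * x + c.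
  under eq_fun do rewrite gE.
  rewrite -[X in a * X]mulr1 -[X in b * X]mulr1 -[X in _ + X]mulr1.
  apply: cvgD; [apply: cvgD|]; do ?apply: cvgMl_tmp.
  - by have := f1 0; under eq_fun do rewrite addn0.
  - by have := f1 1; under eq_fun do rewrite addn1.
  - by have := f1 2; under eq_fun do rewrite addn2.
apply: (cvgr_to_ge glim).
exists N => // M /= NM; rewrite (big_ord_widen M.+2 g); last first.
  by rewrite (leq_trans NM)// -addn2 leq_addr.
rewrite [leRHS](bigID (fun k : 'I_ _ => (k < N)%N))/= lerDl sumr_ge0// => k.
by rewrite -leqNgt => Nk; rewrite /g mulr_ge0 ?g0 ?poisson_mass_ge0.
Qed.

Lemma poisson_mass_sum_le1 x N : 0 <= x -> \sum_(k < N) poisson_mass x k <= 1.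
Proof.
move=> x0; have := @poisson_mass_quad_le x 0 0 1 N x0.
rewrite !mul0r !add0r => le1; apply: le_trans (le1 _).
  by rewrite ler_sum// => k _; rewrite !mul0r !add0r mul1r.
by move=> k _; rewrite !mul0r !add0r.
Qed.

End poisson_mass.

(** * Bernoulli and Poisson laws as generating polynomials *)

Section generating_polynomials.
Context {R : realType}.
Implicit Types (x y p : R) (k N : nat).

Definition bernoulli_poly p : {poly R} := 1 - p *: (1 - 'X).

Definition poisson_poly N x : {poly R} := \poly_(k < N) poisson_mass x k.

Lemma coef_poisson_poly N x k : (k < N)%N -> (poisson_poly N x)`_k = poisson_mass x k.
Proof. by move=> kN; rewrite coef_poly kN. Qed.

Lemma trunc_norm_bernoulli N p : 0 <= p <= 1 -> trunc_norm N (bernoulli_poly p) <= 1.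
Proof.
move=> /andP[p0 p1].
have -> : bernoulli_poly p = (1 - p)%:P + p%:P * 'X.
  by rewrite /bernoulli_poly -mul_polyC polyCB; ring.
have normC c : 0 <= c -> trunc_norm N c%:P <= c.
  move=> c0; rewrite /trunc_norm; case: N => [|N]; first by rewrite big_ord0.
  rewrite big_ord_recl coefC/= ger0_norm// big1 ?addr0// => k _.
  by rewrite coefC/= normr0.
rewrite (le_trans (trunc_normD _ _ _))// -[leRHS](subrK p) lerD ?normC ?subr_ge0//.
by rewrite mulrC -['X]expr1 (le_trans (trunc_norm_XnM _ _ _))// normC.
Qed.

Lemma trunc_norm_poisson N x : 0 <= x -> trunc_norm N (poisson_poly N x) <= 1.
Proof.
move=> x0; apply: le_trans (poisson_mass_sum_le1 x N x0).
by apply: ler_sum => k _; rewrite coef_poisson_poly// ger0_norm ?poisson_mass_ge0.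
Qed.

Lemma poisson_polyD N x y :
  trunc_norm N (poisson_poly N x * poisson_poly N y - poisson_poly N (x + y)) = 0.
Proof.
apply: trunc_norm_eq => k kN; rewrite coefM coef_poisson_poly// -poisson_massD.
apply: eq_bigr => -[i/= ik] _; rewrite !coef_poisson_poly//.
  by rewrite (leq_ltn_trans (leq_subr _ _)).
exact: leq_trans kN.
Qed.

(** The expectation of [(Z - (k + 1))^+] for [Z] of Poisson law of mean [p],
rewritten through [u^+ = u + (- u)^+] as a finite sum. *)
Definition stop_loss p k : R :=
  \sum_(j < k.+1) (k.+1%:R - j%:R) * poisson_mass p j - k.+1%:R + p.

Lemma stop_loss_ge0 p k : 0 <= p -> 0 <= stop_loss p k.
Proof.
move=> p0; have := @poisson_mass_quad_le R p 0 1 (- k.+1%:R) k.+1 p0.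
rewrite !mul0r !add0r mul1r => quad.
rewrite /stop_loss; set S := \sum_(j < _) _.
suff : - S <= p - k.+1%:R by lra.
rewrite -sumrN; apply: le_trans (quad _).
  by rewrite ler_sum// => j _; rewrite mul0r add0r mul1r -mulNr opprB.
by move=> j kj; rewrite mul0r add0r mul1r subr_ge0 ler_nat.
Qed.

(** One difference of the stop-loss sequence gives minus the Poisson tail, so a
second one gives the Poisson mass function. *)
Lemma stop_lossS p k :
  stop_loss p k.+1 - stop_loss p k = \sum_(j < k.+2) poisson_mass p j - 1.
Proof.
rewrite /stop_loss big_ord_recr [in RHS]big_ord_recr/=.
have -> : \sum_(j < k.+1) (k.+2%:R - j%:R) * poisson_mass p j =
    \sum_(j < k.+1) (k.+1%:R - j%:R) * poisson_mass p j + \sum_(j < k.+1) poisson_mass p j.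
  by rewrite -big_split; apply: eq_bigr => j _; rewrite -(natr1 k.+1)/=; ring.
by rewrite -(natr1 k.+1); ring.
Qed.

Lemma sum_stop_loss p N : \sum_(k < N) stop_loss p k =
  2^-1 * \sum_(j < N) (N%:R - j%:R) * (N%:R - j%:R + 1) * poisson_mass p j
  - 2^-1 * (N%:R * (N%:R + 1)) + N%:R * p.
Proof.
elim: N => [|N IH]; first by rewrite !big_ord0; ring.
rewrite big_ord_recr/= IH [in RHS]big_ord_recr/= /stop_loss big_ord_recr/=.
have -> : \sum_(j < N) (N.+1%:R - j%:R) * (N.+1%:R - j%:R + 1) * poisson_mass p j =
    \sum_(j < N) (N%:R - j%:R) * (N%:R - j%:R + 1) * poisson_mass p j +
    2 * \sum_(j < N) (N.+1%:R - j%:R) * poisson_mass p j.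
  by rewrite mulr_sumr -big_split; apply: eq_bigr => j _; rewrite -natr1/=; ring.
by rewrite -natr1; field.
Qed.

(** The sum of [(j - (k + 1))^+] over all [k] is [j (j - 1) / 2], so the total
mass of the stop-loss sequence is half the second factorial moment.  The
comparison of quadratics below avoids summing it exactly. *)
Lemma sum_stop_loss_le p N : 0 <= p -> \sum_(k < N) stop_loss p k <= 2^-1 * p ^+ 2.
Proof.
move=> p0.
have := @poisson_mass_quad_le R p 1 (- (2 * N%:R)) (N%:R * (N%:R + 1)) N p0.
have quadE (j : nat) : 1 * (j%:R * (j%:R - 1)) + - (2 * N%:R) * j%:R + N%:R * (N%:R + 1)
    = (N%:R - j%:R) * (N%:R - j%:R + 1) :> R by ring.
under eq_bigr do rewrite quadE.
move=> quad; rewrite sum_stop_loss; set S := \sum_(j < N) _ in quad *.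
suff : S <= 1 * p ^+ 2 + - (2 * N%:R) * p + N%:R * (N%:R + 1) by lra.
(* [(N - j) (N - j + 1)] is nonnegative at integers, though not on reals. *)
apply: quad => j; rewrite leq_eqVlt => /predU1P[<-|Nj].
  by rewrite quadE subrr mul0r.
rewrite quadE; apply: mulr_le0; first by rewrite subr_le0 ler_nat ltnW.
by rewrite addrAC subr_le0 natr1 ler_nat.
Qed.

Definition stop_loss_poly N p : {poly R} := \poly_(k < N) stop_loss p k.

Lemma trunc_norm_stop_loss N p : 0 <= p ->
  trunc_norm N (stop_loss_poly N p) <= 2^-1 * p ^+ 2.
Proof.
move=> p0; apply: le_trans (sum_stop_loss_le p N p0); apply: ler_sum => k _.
by rewrite coef_poly ltn_ord ger0_norm ?stop_loss_ge0.
Qed.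

(** The Bernoulli and Poisson laws have equal mass and equal mean, so their
difference is twice divisible by [1 - 'X]. *)
Lemma poisson_sub_bernoulli N p :
  trunc_norm N (poisson_poly N p - bernoulli_poly p
                - (1 - 'X) * ((1 - 'X) * stop_loss_poly N p)) = 0.
Proof.
apply: trunc_norm_eq => k kN.
rewrite coefB coef_poisson_poly// /bernoulli_poly coefB coefZ coefB coef1 coefX.
rewrite !coef_1B'XM !coef_poly kN.
case: k kN => [|[|k]] kN /=; rewrite ?coef_1B'XM ?coef_poly.
- by rewrite /stop_loss big_ord_recr big_ord0/= /poisson_mass; ring.
- rewrite (ltnW kN) stop_lossS !big_ord_recr big_ord0/= /stop_loss.
  by rewrite big_ord_recr big_ord0/=; ring.
- rewrite (ltnW kN) (ltnW (ltnW kN)) !stop_lossS [X in X - 1 - _]big_ord_recr/=.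
  by ring.
Qed.

End generating_polynomials.

(** * Poisson approximation of a product of Bernoulli polynomials *)

Section poisson_approximation.
Context {R : realType}.
Implicit Types (x y p : R) (N : nat) (s : seq R) (a : {poly R}).

(** Convolution with the Poisson law is [expR (- p)] times the identity plus
convolution with a measure of mass [1 - expR (- p)], which can cancel at most
that proportion of the norm. *)
Lemma trunc_norm_deconvolve N p a : 0 <= p ->
  (1 - 2 * (1 - expR (- p))) * trunc_norm N a <= trunc_norm N (poisson_poly N p * a).
Proof.
move=> p0; set e := expR (- p).
have rest : trunc_norm N (poisson_poly N p - e%:P) <= 1 - e.
  have [->|N0] := posnP N.
    by rewrite /trunc_norm big_ord0 subr_ge0 -(@expR0 R) ler_expR oppr_le0.
  rewrite lerBrDr; apply: le_trans (poisson_mass_sum_le1 p N p0).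
  case: N N0 => // N _; rewrite /trunc_norm !big_ord_recl.
  rewrite !coefB !coefC coef_poisson_poly//= /poisson_mass expr0 fact0 invr1 !mul1r.
  rewrite subrr normr0 add0r addrC lerD2l; apply: ler_sum => k _.
  rewrite coefB coefC subr0 coef_poisson_poly ?ltnS//.
  by rewrite ger0_norm ?poisson_mass_ge0.
have : e * trunc_norm N a <= trunc_norm N (poisson_poly N p * a) + (1 - e) * trunc_norm N a.
  have -> : e * trunc_norm N a = trunc_norm N (e *: a).
    by rewrite trunc_normZ ger0_norm ?expR_ge0.
  have -> : e *: a = poisson_poly N p * a - (poisson_poly N p - e%:P) * a.
    by rewrite -mul_polyC; ring.
  rewrite (le_trans (trunc_normB _ _ _))// lerD2l (le_trans (trunc_normM _ _ _))//.
  by rewrite ler_wpM2r ?trunc_norm_ge0.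
lra.
Qed.

Lemma deconvolution_factor_gt0 p : p < ln 2 -> 0 < 1 - 2 * (1 - expR (- p)).
Proof.
move=> pln2; have : expR (- ln 2) < expR (- p) by rewrite ltr_expR ltrN2.
by rewrite expRN lnK ?posrE//; lra.
Qed.

(** The second difference is transferred from the stop-loss sequence to [a], so
that the smoothness of [a] is what controls the error. *)
Lemma trunc_norm_poisson_sub_bernoulliM N p a : 0 <= p ->
  trunc_norm N ((poisson_poly N p - bernoulli_poly p) * a) <=
  2^-1 * p ^+ 2 * trunc_norm N ((1 - 'X) * ((1 - 'X) * a)).
Proof.
move=> p0.
apply: (@le_trans _ _ (trunc_norm N (stop_loss_poly N p * ((1 - 'X) * ((1 - 'X) * a))))).
  apply: trunc_norm_congr.
  have <- : (poisson_poly N p - bernoulli_poly p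
      - (1 - 'X) * ((1 - 'X) * stop_loss_poly N p)) * a =
    (poisson_poly N p - bernoulli_poly p) * a
      - stop_loss_poly N p * ((1 - 'X) * ((1 - 'X) * a)) by ring.
  exact/trunc_norm_mul0/poisson_sub_bernoulli.
rewrite (le_trans (trunc_normM _ _ _))// ler_wpM2r ?trunc_norm_ge0//.
exact: trunc_norm_stop_loss.
Qed.

Lemma trunc_norm_poisson_sub_bernoulli N p : 0 <= p ->
  trunc_norm N (poisson_poly N p - bernoulli_poly p) <= 2 * p ^+ 2.
Proof.
move=> p0; rewrite (le_trans (trunc_norm_congr _ _ _ (poisson_sub_bernoulli N p)))//.
rewrite (le_trans (trunc_norm_1B'XM _ _))//.
have := trunc_norm_1B'XM N (stop_loss_poly N p).
have := trunc_norm_stop_loss N p p0; lra.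
Qed.

(** Convolving [poisson_poly N (x - p)] with the Poisson law of mean [p] restores
the mean [x]; deconvolution bounds the cost of undoing this. *)
Lemma trunc_norm_main_term N p x : 0 <= p -> p < ln 2 ->
  trunc_norm N ((poisson_poly N p - bernoulli_poly p) * poisson_poly N (x - p)) <=
  2^-1 * (p ^+ 2 / (1 - 2 * (1 - expR (- p)))) *
    trunc_norm N ((1 - 'X) * ((1 - 'X) * poisson_poly N x)).
Proof.
move=> p0 pln2; have c0 := deconvolution_factor_gt0 p pln2.
rewrite (le_trans (trunc_norm_poisson_sub_bernoulliM _ _ _ p0))//.
rewrite -[leRHS]mulrA -[leLHS]mulrA ler_wpM2l// -[leRHS]mulrA ler_wpM2l ?sqr_ge0//.
rewrite [leRHS]mulrC ler_pdivlMr// [leLHS]mulrC (le_trans (trunc_norm_deconvolve _ _ _ p0))//.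
apply: trunc_norm_congr.
set D := 1 - 'X; set P := poisson_poly N.
have -> : P p * (D * (D * P (x - p))) - D * (D * P x) =
    (P p * P (x - p) - P (p + (x - p))) * (D * D).
  by rewrite [p + _]addrC subrK; ring.
exact/trunc_norm_mul0/poisson_polyD.
Qed.

(** Le Cam's bound, by exchanging one factor at a time; all other factors have
norm at most one. *)
Lemma trunc_norm_prod_bernoulli N s : (forall p, p \in s -> 0 <= p <= 1) ->
  trunc_norm N (\prod_(p <- s) bernoulli_poly p - poisson_poly N (\sum_(p <- s) p))
    <= 2 * \sum_(p <- s) p ^+ 2.
Proof.
elim: s => [|p s IH] s01.
  rewrite !big_nil mulr0 trunc_norm_eq// => k kN.
  rewrite coef_poisson_poly// coef1 /poisson_mass oppr0 expR0 mulr1.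
  by case: k kN => [|k] _; rewrite ?expr0 ?fact0 ?invr1 ?mulr1// expr0n mul0r.
have p01 : 0 <= p <= 1 by rewrite s01// mem_head.
have {}s01 q : q \in s -> 0 <= q <= 1 by move=> qs; rewrite s01// in_cons qs orbT.
have sum0 : 0 <= \sum_(q <- s) q.
  by rewrite big_seq sumr_ge0// => q /s01/andP[].
rewrite !big_cons; set B := \prod_(_ <- _) _; set L := \sum_(q <- s) q.
set P := poisson_poly N; set b := bernoulli_poly p.
apply: (@le_trans _ _ (trunc_norm N (b * (B - P L) - (P p - b) * P L))).
  apply: trunc_norm_congr; rewrite -[RHS](poisson_polyD N p L); congr trunc_norm.
  by rewrite -/P; ring.
rewrite (le_trans (trunc_normB _ _ _))// [leRHS]mulrDr [leRHS]addrC lerD//.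
  rewrite (le_trans (trunc_normM _ _ _))// -[leRHS]mul1r.
  by rewrite ler_pM ?trunc_norm_ge0 ?trunc_norm_bernoulli// IH.
have p0 : 0 <= p by case/andP: p01.
rewrite (le_trans (trunc_normM _ _ _))// -[leRHS]mulr1.
by rewrite ler_pM ?trunc_norm_ge0 ?trunc_norm_poisson_sub_bernoulli ?trunc_norm_poisson.
Qed.

(** Adding one parameter [p] to [s] creates a new product of two differences,
[(poisson p - bernoulli p)] times the Le Cam error of [s], of norm at most
[2 p^2] times [2 S] where [S] is the sum of the squares over [s].  This is
absorbed by the cross term of [(p^2 + S)^2]. *)
Lemma trunc_norm_prod_bernoulli2 N s : (forall p, p \in s -> 0 <= p <= 1) ->
  trunc_norm N (\prod_(p <- s) bernoulli_poly p - poisson_poly N (\sum_(p <- s) p)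
    + \sum_(q <- s) (poisson_poly N q - bernoulli_poly q)
                    * poisson_poly N (\sum_(p <- s) p - q))
    <= 2 * (\sum_(p <- s) p ^+ 2) ^+ 2.
Proof.
elim: s => [|p s IH] s01.
  have := trunc_norm_prod_bernoulli N [::] s01.
  by rewrite !big_nil expr0n !mulr0 addr0.
have p01 : 0 <= p <= 1 by rewrite s01// mem_head.
have {}s01 q : q \in s -> 0 <= q <= 1 by move=> qs; rewrite s01// in_cons qs orbT.
have p0 : 0 <= p by case/andP: p01.
have le1 := trunc_norm_prod_bernoulli N s s01.
have {IH} := IH s01.
rewrite !big_cons; move: le1; set B := \prod_(_ <- _) _; set L := \sum_(q <- s) q.
set P := poisson_poly N; set b := bernoulli_poly; set S := \sum_(_ <- _) _ ^+ 2.
set E := \sum_(_ <- _) _ => le1 le2.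
have S0 : 0 <= S by apply: sumr_ge0 => q _; exact: sqr_ge0.
set E' := \sum_(_ <- _) _.
have EE' : trunc_norm N (E' - P p * E) = 0.
  apply/eqP; rewrite eq_le trunc_norm_ge0 andbT mulr_sumr -sumrB.
  rewrite (le_trans (trunc_norm_sum _ _ _ _))// big1// => q _.
  rewrite -trunc_normN -addrA.
  have -> : - ((P q - b q) * P (p + (L - q)) - P p * ((P q - b q) * P (L - q))) =
    (P p * P (L - q) - P (p + (L - q))) * (P q - b q) by ring.
  exact/trunc_norm_mul0/poisson_polyD.
apply: (@le_trans _ _ (trunc_norm N (P p * (B - P L + E) - (P p - b p) * (B - P L)))).
  apply: trunc_norm_congr; apply/eqP; rewrite eq_le trunc_norm_ge0 andbT.
  have -> : p + L - p = L by ring.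
  rewrite [X in trunc_norm N X](_ : _ = P p * P L - P (p + L) + (E' - P p * E)).
    by rewrite (le_trans (trunc_normD _ _ _))// EE' poisson_polyD addr0.
  by ring.
rewrite (le_trans (trunc_normB _ _ _))//.
have h1 : trunc_norm N (P p * (B - P L + E)) <= 2 * S ^+ 2.
  rewrite (le_trans (trunc_normM _ _ _))// -[leRHS]mul1r.
  by rewrite ler_pM ?trunc_norm_ge0 ?trunc_norm_poisson.
have h2 : trunc_norm N ((P p - b p) * (B - P L)) <= 2 * p ^+ 2 * (2 * S).
  rewrite (le_trans (trunc_normM _ _ _))//.
  by rewrite ler_pM ?trunc_norm_ge0 ?trunc_norm_poisson_sub_bernoulli.
apply: (le_trans (lerD h1 h2)).
have : 0 <= (p ^+ 2) ^+ 2 by exact: sqr_ge0.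
by rewrite sqrrD; lra.
Qed.

(** The factor [2^-1] converts norms of differences of probability laws into
total variation distances. *)
Lemma half_trunc_norm_prod_bernoulli N s (L := \sum_(p <- s) p) :
  (forall p, p \in s -> 0 <= p <= 1) -> (forall p, p \in s -> p < ln 2) ->
  2^-1 * trunc_norm N (\prod_(p <- s) bernoulli_poly p - poisson_poly N L) <=
  (\sum_(p <- s) p ^+ 2) ^+ 2
  + 4^-1 * trunc_norm N ((1 - 'X) * ((1 - 'X) * poisson_poly N L))
    * \sum_(p <- s) p ^+ 2 / (1 - 2 * (1 - expR (- p))).
Proof.
move=> s01 sln2; have := trunc_norm_prod_bernoulli2 N s s01; rewrite -/L.
set A := _ - poisson_poly N L; set E := \sum_(_ <- _) _.
set D := trunc_norm N (_ * (_ * _)); set S := \sum_(_ <- _) _ / _ => le2.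
have leE : trunc_norm N E <= 2^-1 * S * D.
  rewrite (le_trans (trunc_norm_sum _ _ _ _))// [X in X * _]mulr_sumr mulr_suml.
  rewrite big_seq [leRHS]big_seq ler_sum// => q qs.
  by apply: trunc_norm_main_term; [case/andP: (s01 q qs)|exact: sln2].
have : trunc_norm N A <= trunc_norm N (A + E) + trunc_norm N E.
  by rewrite -{1}(addrK E A) trunc_normB.
lra.
Qed.

End poisson_approximation.

(** * Total variation distance between laws on the integers *)

Lemma sum_measure_le {R : realType} {d} {T : measurableType d}
    (mu : {measure set T -> \bar R}) {I : choiceType} (s : seq I) (F : I -> set T)
    (A : set T) :
  uniq s -> (forall i, measurable (F i)) -> trivIset [set` s] F ->
  measurable A -> (forall i, i \in s -> F i `<=` A) ->
  (\sum_(i <- s) mu (F i) <= mu A)%E.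
Proof.
move=> us mF tF mA FA; rewrite fsbig_seq//= -measure_fin_bigcup//.
apply: le_measure; rewrite ?inE//; first exact: fin_bigcup_measurable.
exact: bigcup_sub.
Qed.

Section total_variation.
Context {R : realType}.
Implicit Types (mu nu : probability int R) (A : set int).

(** The upper bound is the lower bound for the complement of [A]; in this way
only finitely many atoms are ever summed. *)
Lemma fine_probability_bounds mu A N :
  \sum_(k < N | Posz k \in A) pmfZ mu k <= fine (mu A) /\
  fine (mu A) <= 1 - \sum_(k < N | Posz k \notin A) pmfZ mu k.
Proof.
have lower B : \sum_(k < N | Posz k \in B) pmfZ mu k <= fine (mu B).
  rewrite -lee_fin fineK ?fin_num_measure// -sumEFin -big_filter.
  rewrite (eq_bigr (fun k : 'I_N => mu [set Posz k])); last first.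
    by move=> k _; rewrite /pmfZ fineK// fin_num_measure.
  apply: (@sum_measure_le _ _ _ mu _ _ (fun k : 'I_N => [set Posz k])) => //.
  - by rewrite filter_uniq// index_enum_uniq.
  - by move=> i j _ _ [z [->] [/val_inj]].
  - by move=> k; rewrite mem_filter => /andP[/set_mem kB _] z ->.
split; first exact: lower.
have := lower (~` A); rewrite probability_setC// fineB ?fin_num_measure//=.
by under eq_bigl do rewrite in_setC; lra.
Qed.

(** The two limits say that the laws live on the nonnegative integers; their
masses outside the first [N] integers are the error made by looking at these
only. *)
Lemma dTV_le_half_l1 mu nu (C : \bar R) :
  \sum_(k < N) pmfZ mu k @[N --> \oo] --> (1 : R^o) ->
  \sum_(k < N) pmfZ nu k @[N --> \oo] --> (1 : R^o) ->
  (forall N, ((2^-1 * \sum_(k < N) `|pmfZ mu k - pmfZ nu k|)%:E <= C)%E) ->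
  (dTV mu nu <= C)%E.
Proof.
move=> mu1 nu1; case: C => [c||] le_c; last 2 first.
- by rewrite leey.
- by have := le_c 0%N; rewrite leeNy_eq.
have fin_le A (ka la : probability int R) :
    \sum_(k < N) pmfZ ka k @[N --> \oo] --> (1 : R^o) ->
    \sum_(k < N) pmfZ la k @[N --> \oo] --> (1 : R^o) ->
    (forall N, 2^-1 * \sum_(k < N) `|pmfZ ka k - pmfZ la k| <= c) ->
    fine (ka A) - fine (la A) <= c.
  move=> ka1 la1 lec.
  (* The mean of the two masses outside the first [N] nonnegative integers. *)
  pose f N : R := 1 - 2^-1 * (\sum_(k < N) pmfZ ka k + \sum_(k < N) pmfZ la k).
  have f0 : f N @[N --> \oo] --> (1 - 2^-1 * (1 + 1) : R^o).
    by apply: cvgB; [exact: cvg_cst|apply: cvgMl_tmp; exact: cvgD].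
  suff : fine (ka A) - fine (la A) - c <= 1 - 2^-1 * (1 + 1) by lra.
  apply: (cvgr_to_ge f0); apply: nearW => N; rewrite /f.
  have [_ up] := fine_probability_bounds ka A N.
  have [lo _] := fine_probability_bounds la A N.
  have := lec N; move: up lo.
  have splitA (F : nat -> R) : \sum_(k < N) F k =
      \sum_(k < N | Posz k \in A) F k + \sum_(k < N | Posz k \notin A) F k.
    exact: bigID.
  rewrite (splitA (pmfZ ka)) (splitA (pmfZ la)).
  rewrite (splitA (fun k => `|pmfZ ka k - pmfZ la k|)).
  have : \sum_(k < N | Posz k \in A) pmfZ ka k - \sum_(k < N | Posz k \in A) pmfZ la k
     <= \sum_(k < N | Posz k \in A) `|pmfZ ka k - pmfZ la k|.
    by rewrite -sumrB ler_sum// => k _; exact: ler_norm.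
  have : \sum_(k < N | Posz k \notin A) pmfZ la k - \sum_(k < N | Posz k \notin A) pmfZ ka k
     <= \sum_(k < N | Posz k \notin A) `|pmfZ ka k - pmfZ la k|.
    by rewrite -sumrB ler_sum// => k _; rewrite distrC; exact: ler_norm.
  lra.
apply: ge_ereal_sup => _ [A _ <-].
rewrite -[mu A]fineK ?fin_num_measure// -[nu A]fineK ?fin_num_measure//.
rewrite -EFinB abse_EFin lee_fin ler_norml lerNl opprB; apply/andP; split.
  apply: fin_le => // N; rewrite -lee_fin; apply: le_trans (le_c N).
  by under eq_bigr do rewrite distrC.
by apply: fin_le => // N; rewrite -lee_fin.
Qed.

End total_variation.

(** * The laws of the sum and of its Poisson approximation *)

Section law_of_sum.
Context {R : realType}.

(** The sets [J] are the possible sets of successes. *)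
Lemma coef_prod_bernoulli_poly {I : finType} (p : I -> R) k :
  (\prod_i bernoulli_poly (p i))`_k =
  \sum_(J : {set I} | #|J| == k) \prod_i (if i \in J then p i else 1 - p i).
Proof.
have bE i : bernoulli_poly (p i) = p i *: 'X + (1 - p i)%:P.
  by rewrite /bernoulli_poly -!mul_polyC polyCB; ring.
rewrite (eq_bigr _ (fun i _ => bE i)) bigA_distr/= coef_sum [RHS]big_mkcond/=.
apply: eq_bigr => J _.
have -> : \prod_i (if i \in J then p i *: 'X else (1 - p i)%:P) =
    (\prod_i (if i \in J then p i else 1 - p i))%:P * 'X^#|J| :> {poly R}.
  rewrite rmorph_prod/= -[#|J|]sum1_card -prodrXr [X in _ * X]big_mkcond -big_split/=.
  by apply: eq_bigr => i _; case: ifP; rewrite ?mulr1 ?mul_polyC.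
by rewrite coefCM coefXn eq_sym; case: eqP; rewrite ?mulr1 ?mulr0.
Qed.

Lemma sum_coef_prod_bernoulli_poly {I : finType} (p : I -> R) N
    (b := \prod_i bernoulli_poly (p i)) : (size b <= N)%N -> \sum_(k < N) b`_k = 1.
Proof.
move=> bN; have := horner_coef_wide 1 bN.
under [in RHS]eq_bigr do rewrite expr1n mulr1.
move=> <-; rewrite /b horner_prod big1// => i _.
by rewrite /bernoulli_poly !hornerE subrr mulr0 subr0.
Qed.

Context {d} {T : measurableType d} (P : probability T R) {I : finType}
  (X : I -> {RV P >-> int}) (p : I -> R).
Context (indepX : independent_RVs P X)
  (bernX : forall i, bernoulli_RV P (X i) (p i)).

Lemma bernoulli_RV_param i : 0 <= p i <= 1.
Proof.
have [p1 _] := bernX i; apply/andP; split.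
  by rewrite -lee_fin -p1.
by rewrite -lee_fin -p1 probability_le1//; exact: measurable_funPTI.
Qed.

(** The event that the successes are exactly the elements of [J] has the product
probability by independence, and these events are disjoint for distinct [J].
Only an inequality follows at once, because the variables may take values
other than [0] and [1] on a null set. *)
Lemma pmfZ_sum_bernoulli_ge (k : nat) :
  (\prod_i bernoulli_poly (p i))`_k <= pmfZ (distribution P (sum_int X)) k.
Proof.
rewrite coef_prod_bernoulli_poly.
pose E (J : {set I}) := \bigcap_(i in [set` [set: I]%SET]) (X i @^-1` [set Posz (i \in J)]).
have mE J : measurable (E J).
  apply: fin_bigcap_measurable => // i _.
  exact: measurable_funPTI.
have PE J : P (E J) = (\prod_i (if i \in J then p i else 1 - p i))%:E.
  rewrite /E indepX// -prodEFin; apply: eq_big => [i|i _]; first by rewrite inE.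
  by have [b1 b0] := bernX i; case: (i \in J).
rewrite -lee_fin fineK ?fin_num_measure// -sumEFin -big_filter.
rewrite (eq_bigr (fun J => P (E J))) => [|J _]; last by rewrite PE.
apply: (@sum_measure_le _ _ _ P _ _ E) => //.
- by rewrite filter_uniq// index_enum_uniq.
- move=> J K _ _ [w [wJ wK]]; apply/setP => i.
  have := wJ i (finset.in_setT i); have := wK i (finset.in_setT i); rewrite /= => -> [].
  by case: (i \in J); case: (i \in K).
- exact: measurable_funPTI.
move=> J; rewrite mem_filter => /andP[/eqP <- _] w wJ /=.
rewrite /sum_int (eq_bigr (fun i => (i \in J)%:R)) => [|i _]; last first.
  by rewrite (wJ i (finset.in_setT i)); case: (i \in J).
rewrite -natr_sum -[#|J|]sum1_card [in RHS]big_mkcond natz/=.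
by congr Posz; apply: eq_bigr => i _; case: (i \in J).
Qed.

(** The coefficients of the product already have total mass one, so no inequality
in the previous bound can be strict. *)
Lemma pmfZ_sum_bernoulli (k : nat) :
  pmfZ (distribution P (sum_int X)) k = (\prod_i bernoulli_poly (p i))`_k.
Proof.
set mu := distribution _ _; set b := \prod_i _; pose N := maxn k.+1 (size b).
have kN : (k < N)%N by rewrite leq_max ltnSn.
have [le1 _] := fine_probability_bounds mu setT N.
have b1 : \sum_(k < N) b`_k = 1.
  by apply: sum_coef_prod_bernoulli_poly; rewrite leq_maxr.
apply/eqP; rewrite eq_le pmfZ_sum_bernoulli_ge andbT -subr_le0.
apply: (@le_trans _ _ (\sum_(j < N) (pmfZ mu j - b`_j))).
  rewrite (bigD1 (Ordinal kN))//= lerDl sumr_ge0// => j _.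
  by rewrite subr_ge0 pmfZ_sum_bernoulli_ge.
rewrite sumrB b1 subr_le0; move: le1; rewrite probability_setT.
by under eq_bigl do rewrite in_setT.
Qed.

End law_of_sum.

Section poisson_law.
Context {R : realType}.
Implicit Types (x : R) (N : nat).

Lemma pmfZ_poissonZ_nat x k : 0 <= x -> pmfZ (poissonZ x) (Posz k) = poisson_mass x k.
Proof. exact: pmfZ_poissonZ. Qed.

Lemma trunc_norm_diff2_le_l1normZ x N : 0 <= x ->
  ((trunc_norm N ((1 - 'X) * ((1 - 'X) * poisson_poly N x)))%:E <=
   l1normZ (backward_diff (backward_diff (pmfZ (poissonZ x)))))%E.
Proof.
move=> x0; set f := backward_diff _.
have fE k : (k < N)%N -> ((1 - 'X) * ((1 - 'X) * poisson_poly N x))`_k = f (Posz k).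
  have neg (m : nat) : pmfZ (poissonZ x) (- m.+1%:Z) = 0.
    by rewrite -NegzE pmfZ_poissonZ.
  have S1 (m : nat) : m.+1%:Z - 1 = m%:Z by rewrite intS addrC addKr.
  move=> kN; rewrite /f /backward_diff !coef_1B'XM.
  case: k kN => [|[|k]] kN; rewrite ?S1 ?pmfZ_poissonZ_nat// ?coef_1B'XM ?coef_poisson_poly//.
  - rewrite (_ : 0 - 1 = - 1%:Z)// (_ : - 1%:Z - 1 = - 2%:Z)// !neg.
    by rewrite !subr0.
  - by rewrite (_ : 0 - 1 = - 1%:Z)// neg.
  - exact: ltnW.
  - exact: ltnW (ltnW kN).
  - exact: ltnW.
apply: esum_ge; exists [set Posz k | k in `I_N].
  by split => //; exact: finite_image.
rewrite fsbig_image; last by move=> i j _ _ [].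
rewrite -fsbig_ord sumEFin lee_fin ler_sum// => k _.
by rewrite fE.
Qed.

End poisson_law.

(** * The approximation theorem *)

Theorem corollary10 (R : realType) (d : measure_display)
    (T : measurableType d) (P : probability T R)
    (n : nat) (X : 'I_n -> {RV P >-> int}) (p : 'I_n -> R)
    (indepX : independent_RVs P X)
    (bernX : forall i, bernoulli_RV P (X i) (p i))
    (p_lt_ln2 : forall i, p i < ln 2) :
  let lambda := \sum_(i < n) p i in
  (dTV (distribution P (sum_int X)) (poissonZ lambda) <=
   ((\sum_(i < n) p i ^+ 2) ^+ 2)%:E +
   (4^-1)%:E
   * l1normZ (backward_diff (backward_diff (pmfZ (poissonZ lambda))))
   * (\sum_(i < n) p i ^+ 2 / (1 - 2 * (1 - expR (- p i))))%:E)%E.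
Proof.
cbv zeta; set lambda := \sum_(i < n) p i.
have p01 i : 0 <= p i <= 1 := bernoulli_RV_param P X p bernX i.
have lambda0 : 0 <= lambda by apply: sumr_ge0 => i _; case/andP: (p01 i).
set b := \prod_i bernoulli_poly (p i).
have muE (k : nat) : pmfZ (distribution P (sum_int X)) k = b`_k.
  exact: pmfZ_sum_bernoulli indepX bernX k.
apply: dTV_le_half_l1 => [||N].
- under eq_fun do under eq_bigr do rewrite muE.
  apply: cvg_near_cst; exists (size b) => // N /= bN.
  exact: sum_coef_prod_bernoulli_poly.
- under eq_fun do under eq_bigr do rewrite pmfZ_poissonZ_nat//.
  exact: poisson_mass_cvg1.
pose s := [seq p i | i <- index_enum 'I_n].
have s01 q : q \in s -> 0 <= q <= 1 by case/mapP => i _ ->.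
have sln2 q : q \in s -> q < ln 2 by case/mapP => i _ ->.
have := half_trunc_norm_prod_bernoulli N s s01 sln2.
rewrite !big_map -/lambda -/b; set S := \sum_(i < n) p i ^+ 2 / _ => le_half.
have S0 : 0 <= S.
  apply: sumr_ge0 => i _; rewrite divr_ge0 ?sqr_ge0// ltW//.
  exact: deconvolution_factor_gt0.
apply: (@le_trans _ _ (2^-1 * trunc_norm N (b - poisson_poly N lambda))%:E).
  rewrite lee_fin ler_wpM2l// ler_sum// => k _.
  by rewrite muE pmfZ_poissonZ_nat// coefB coef_poisson_poly.
move: le_half; rewrite -lee_fin => /le_trans; apply.
rewrite EFinD leeD2l// EFinM lee_wpmul2r ?lee_fin// EFinM lee_wpmul2l ?lee_fin//.
exact: trunc_norm_diff2_le_l1normZ.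
Qed.
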